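(* For every $n\ge1$, the composition $\Psi\circ\psi$ is a bijection from $\mathcal{S}_n$ to $\mathcal{P}_n$.
   Context: Snakes. A snake of length $n$ is a word $p_1\cdots p_n$ with $p_i\in\{\pm1,\dots,\pm n\}$ such that: - $|p_1|\cdots|p_n|$ is a permutation of $[n]$; - $p_1>0$; - $p_1>p_2<p_3>p_4<\cdots$. Let $\mathcal{S}_n$ be the set of snakes of length $n$. rc-invariant alternating permutations. Let $\mathfrak{R}_n$ be the set of permutations $\pi$ of $[2n]$ with $\pi_1>\pi_2<\pi_3>\cdots$ and $\pi_{2n+1-i}=2n+1-\pi_i$ for all $i$. The map $\psi:\mathcal{S}_n\to\mathfrak{R}_n$. For $p\in\mathcal{S}_n$, let $\tilde p_i=n+p_i$ if $p_i>0$ and $\tilde p_i=n+1+p_i$ if $p_i<0$. Then $\psi(p)$ is the unique rc-invariant permutation of $[2n]$ such that: - if $n$ is odd, its first $n$ entries are $\tilde p_n\cdots\tilde p_1$; - if $n$ is even, its last $n$ entries are $\tilde p_1\cdots\tilde p_n$. Heights. For a word $P=p_1\cdots p_N$ of steps with $U=(1,1)$ and $D=(1,-1)$, the height of step $i$ is $h_i(P)=|\{j<i:p_j=U\}|-|\{j<i:p_j=D\}|$. The map $\Psi:\mathfrak{R}_n\to\mathcal{P}_n$. For $\pi\in\mathfrak{R}_n$, set $\pi_0=0$, $\pi_{2n+1}=+\infty$. For each $i\in[2n]$ with $\pi_j=i$: - $m_i=U$ if $\pi_{j-1}>\pi_j<\pi_{j+1}$; - $m_i=D$ if $\pi_{j-1}<\pi_j>\pi_{j+1}$;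 - $w_i=|\{k:k<j,\ \pi_k<\pi_j=i<\pi_{k-1}\}|$. Since $\pi$ is alternating, every $i$ falls in one of these two cases. Then $\Psi(\pi)=(m_1\cdots m_n,\,w_1\cdots w_n)$. Labeled ballot paths. A labeled ballot path of length $n$ is a pair $(P,w)$ where $P=p_1\cdots p_n\in\{U,D\}^n$ has all partial heights $\ge0$ (it may end at any height), and $w\in\mathbb{N}^n$ satisfies $0\le w_i\le h_i(P)$ if $p_i=U$ and $0\le w_i\le h_i(P)-1$ if $p_i=D$. Let $\mathcal{P}_n$ be the set of these. *)

(* Defs.v *)
From mathcomp Require Import all_boot all_order all_algebra.
Import GRing.Theory Num.Theory Order.TTheory.

Set Implicit Arguments.
Unset Strict Implicit.
Unset Printing Implicit Defensive.

(* Words are 0-indexed seqs: the paper's p_i is [nth _ p (i-1)]. *)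

Definition is_snake (n : nat) (p : seq int) : bool :=
  [&& size p == n,
      perm_eq (map absz p) (iota 1 n),
      (0 < nth 0 p 0)%R
    & all (fun i => if odd i then (nth 0 p i < nth 0 p i.+1)%R
                    else (nth 0 p i.+1 < nth 0 p i)%R)
          (iota 0 n.-1)].

Definition is_rc_alt (n : nat) (s : seq nat) : bool :=
  [&& size s == 2 * n,
      perm_eq s (iota 1 (2 * n)),
      all (fun i => if odd i then nth 0 s i < nth 0 s i.+1
                    else nth 0 s i.+1 < nth 0 s i) (iota 0 (2 * n).-1)
    & all (fun i => nth 0 s (2 * n - 1 - i) == (2 * n).+1 - nth 0 s i)
          (iota 0 (2 * n))].

Definition tilde (n : nat) (x : int) : nat :=
  if (0 < x)%R then n + absz x else n.+1 - absz x.

(** psi : the rc-invariant word of length 2n determined by the prescribed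
    half (the other half is forced by pi_{2n+1-i} = 2n+1 - pi_i). *)
Definition psi (n : nat) (p : seq int) : seq nat :=
  let t := map (tilde n) p in
  let c := fun x => (2 * n).+1 - x in
  if odd n then
    let f := rev t in f ++ map c (rev f)
  else
    map c (rev t) ++ t.

(** Extended word: pi_0 = 0, pi_k for 1<=k<=2n, and pi_{2n+1} = "+infinity",
    represented by a value strictly larger than every entry. *)
Definition ext (s : seq nat) (k : nat) : nat :=
  if k == 0 then 0
  else if k <= size s then nth 0 s k.-1
  else (foldr maxn 0 s).+1.

(** Steps: true = U, false = D. *)
Definition Psi_m (s : seq nat) (i : nat) : bool :=
  let j := (index i s).+1 in (ext s j < ext s j.-1) && (ext s j < ext s j.+1).

Definition Psi_w (s : seq nat) (i : nat) : nat :=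
  let j := (index i s).+1 in
  count (fun k => (ext s k < i) && (i < ext s k.-1)) (iota 1 j.-1).

Definition Psi (n : nat) (s : seq nat) : seq bool * seq nat :=
  ([seq Psi_m s i | i <- iota 1 n], [seq Psi_w s i | i <- iota 1 n]).

(** height h_{i+1}(P) of the (i+1)-th step (i = number of previous steps). *)
Definition height (P : seq bool) (i : nat) : int :=
  ((count id (take i P))%:Z - (count negb (take i P))%:Z)%R.

Definition is_ballot (n : nat) (q : seq bool * seq nat) : bool :=
  [&& size q.1 == n, size q.2 == n,
      all (fun i => (0 <= height q.1 i)%R) (iota 0 n.+1)
    & all (fun i => if nth false q.1 i
                    then ((nth 0 q.2 i)%:Z <= height q.1 i)%R
                    else ((nth 0 q.2 i)%:Z <= height q.1 i - 1)%R)
          (iota 0 n)].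

(* Main.v *)
Require Import Defs.
From mathcomp Require Import all_boot all_order all_algebra.
From mathcomp Require Import zify.

Set Implicit Arguments.
Unset Strict Implicit.
Unset Printing Implicit Defensive.

(* Surround an rc-invariant alternating permutation pi by 0 and 2n+1 and keep
   only the entries <= i: the word breaks into maximal runs, the "blocks".
   Going from i-1 to i, a valley i inserts the new block [i] and a peak i glues
   two consecutive blocks around i; the place where this happens is exactly w_i,
   because the runs to the left of i, apart from the one containing 0, are
   entered by the descents that w_i counts. The number of blocks is thus one more
   than the height, which gives the bounds on w_i. A step can be undone by
   looking for i in the blocks, so the code (m, w) up to n and the list of blocks
   of the entries <= n determine each other. By rc-invariance the complementary
   runs (entries > n) are the reverse-complements of these blocks in reverse
   order, so pi is recovered by interleaving; conversely the interleaving of any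
   list of blocks reachable by such steps is rc-invariant and alternating. *)

(** * Alternating words *)

(** [up] is the direction of the next comparison. The first letter is a separate argument so that
    [alt_cat] can hand over the last letter of a prefix. *)
Fixpoint alt (T : Type) (r : rel T) (up : bool) (x : T) (s : seq T) : bool :=
  if s is y :: s' then (if up then r x y else r y x) && alt r (~~ up) y s'
  else true.

Lemma alt_cat (T : Type) (r : rel T) up x a b :
  alt r up x (a ++ b) =
  alt r up x a && alt r (up (+) odd (size a)) (last x a) b.
Proof.
elim: a up x => [|y a IH] up x /=; first by rewrite addbF.
by rewrite IH -andbA addNb -addbN.
Qed.

(** The last of the [size s] comparisons has direction [up (+) ~~ odd (size s)], and reading it
    backwards flips it. *)
Lemma alt_rev (T : Type) (r : rel T) up x s :
  alt r (up (+) odd (size s)) (last x s) (rev (belast x s)) = alt r up x s.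
Proof.
elim: s up x => [|y s IH] up x //=.
rewrite rev_cons -cats1 alt_cat /= andbT addbN -addNb IH andbC.
have -> : last (last y s) (rev (belast y s)) = y.
  by case: s {IH} => //= z s; rewrite rev_cons last_rcons.
rewrite size_rev size_belast -addbA addbb addbF.
by case: up.
Qed.

Lemma alt_map (T U : eqType) (r : rel T) (q : rel U) (f : T -> U) up x s :
    {in x :: s &, forall a b, q (f a) (f b) = r a b} ->
  alt q up (f x) (map f s) = alt r up x s.
Proof.
elim: s up x => [|y s IH] up x //= fq.
rewrite IH => [|a b aP bP]; last by apply: fq; rewrite inE ?aP ?bP orbT.
by rewrite !fq // !inE eqxx ?orbT.
Qed.

Lemma alt_converse (T : Type) (r : rel T) up x s :
  alt (fun a b => r b a) up x s = alt r (~~ up) x s.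
Proof. by elim: s up x => [|y s IH] up x //=; rewrite IH; case: up. Qed.

(** With [up := false] the left side is the index-wise condition of [is_snake]. *)
Lemma alt_nth (T : Type) (r : rel T) x0 up x s :
  all (fun i => if odd i (+) up then r (nth x0 (x :: s) i) (nth x0 (x :: s) i.+1)
                else r (nth x0 (x :: s) i.+1) (nth x0 (x :: s) i))
      (iota 0 (size s)) = alt r up x s.
Proof.
elim: s up x => [|y s IH] up x //=.
rewrite -IH (iotaDl 1 0) all_map; congr (_ && _).
by apply: eq_all => i; rewrite /= addNb addbN.
Qed.

(** * Maximal runs of letters satisfying a predicate *)

(** Empty pieces are kept so that the recursion only ever touches the first piece; [runs] discards
    them afterwards. *)
Fixpoint splits (T : Type) (P : pred T) (s : seq T) : seq (seq T) :=
  if s is x :: s' then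
    let t := splits P s' in
    if P x then (x :: head [::] t) :: behead t else [::] :: t
  else [:: [::]].

Definition runs (T : Type) (P : pred T) (s : seq T) : seq (seq T) :=
  [seq b <- splits P s | ~~ nilp b].

Lemma eq_in_splits (T : eqType) (P Q : pred T) s :
  {in s, P =1 Q} -> splits P s = splits Q s.
Proof.
elim: s => [|x s IH] //= PQ.
rewrite IH => [|y ys]; last by rewrite PQ // inE ys orbT.
by rewrite PQ // inE eqxx.
Qed.

Lemma eq_in_runs (T : eqType) (P Q : pred T) s :
  {in s, P =1 Q} -> runs P s = runs Q s.
Proof. by move=> PQ; rewrite /runs (eq_in_splits PQ). Qed.

Lemma splits_cons (T : Type) (P : pred T) s :
  splits P s = head [::] (splits P s) :: behead (splits P s).
Proof. by case: s => [|x s] //=; case: (P x). Qed.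

Lemma splits_cat0 (T : Type) (P : pred T) a x b :
  ~~ P x -> splits P (a ++ x :: b) = splits P a ++ splits P b.
Proof.
move=> /negbTE Px; elim: a => [|y a IH] /=; first by rewrite Px.
by rewrite IH (splits_cons P a) /=; case: (P y).
Qed.

Lemma runs_cat0 (T : Type) (P : pred T) a x b :
  ~~ P x -> runs P (a ++ x :: b) = runs P a ++ runs P b.
Proof. by move=> Px; rewrite /runs splits_cat0 // filter_cat. Qed.

(** No cut is made between [a] and [b], so the pieces meeting there join; this is how a peak will
    glue two blocks. *)
Lemma splits_catP (T : Type) (P : pred T) a b :
  exists A u, splits P a = rcons A u /\
  splits P (a ++ b) =
    A ++ (u ++ head [::] (splits P b)) :: behead (splits P b).
Proof.
elim: a => [|x a [A [u [aE abE]]]] /=.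
  by exists [::], [::]; rewrite -splits_cons.
rewrite aE abE; case: (P x); last by exists ([::] :: A), u.
case: A {aE abE} => [|v A] /=; first by exists [::], (x :: u).
by exists ((x :: v) :: A), u.
Qed.

Lemma nilp_head_splits (T : Type) (P : pred T) x s :
  nilp (head [::] (splits P (x :: s))) = ~~ P x.
Proof. by rewrite /=; case: (P x). Qed.

Lemma nilp_last_splits (T : Type) (P : pred T) x s A u :
  splits P (rcons s x) = rcons A u -> nilp u = ~~ P x.
Proof.
rewrite -(cats1 s); have [B [v [_ ->]]] := splits_catP P s [:: x].
rewrite /=; case: (P x) => /=; rewrite ?cats1 => eAu.
  by case/rcons_inj: eAu => _ <-; rewrite /nilp size_rcons.
by move: eAu; rewrite -cat_rcons ?cats1 => /rcons_inj[_ <-].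
Qed.

Lemma splits_rev (T : Type) (P : pred T) s :
  splits P (rev s) = rev (map rev (splits P s)).
Proof.
elim: s => [|x s IH] //=; rewrite rev_cons -cats1.
case Px: (P x); last by rewrite splits_cat0 ?Px // IH rev_cons cats1.
have [A [u [sE ->]]] := splits_catP P (rev s) [:: x].
move: IH; rewrite sE (splits_cons P s) /= Px /= !rev_cons => /rcons_inj[<- ->].
by rewrite cats1 cats1.
Qed.

Lemma runs_rev (T : Type) (P : pred T) s :
  runs P (rev s) = rev (map rev (runs P s)).
Proof.
rewrite /runs splits_rev filter_rev filter_map; congr (rev (map _ _)).
by apply: eq_filter => x; rewrite /= /nilp size_rev.
Qed.

Lemma runs_map (T U : Type) (f : T -> U) (P : pred U) s :
  runs P (map f s) = map (map f) (runs (preim f P) s).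
Proof.
have ->: runs P (map f s) =
    [seq b <- map (map f) (splits (preim f P) s) | ~~ nilp b].
  congr filter; elim: s => [|x s IH] //=.
  by rewrite IH (splits_cons (preim f P) s) /=; case: (P (f x)).
rewrite filter_map; congr (map _ _).
by apply: eq_filter => x; rewrite /= /nilp size_map.
Qed.

Lemma runs_none (T : Type) (P : pred T) a b :
  all (predC P) a -> runs P (a ++ b) = runs P b.
Proof.
by elim: a => [|x a IH] //= /andP[/negbTE Px aP]; rewrite /runs /= Px /= -[RHS]IH.
Qed.

Lemma runs_all (T : Type) (P : pred T) a :
  all P a -> ~~ nilp a -> runs P a = [:: a].
Proof.
move=> aP a0; have aE : splits P a = [:: a].
  by elim: a aP {a0} => [|x a IH] //= /andP[-> /IH->].
by rewrite /runs aE /= a0.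
Qed.

Lemma runs_consT (T : Type) (P : pred T) x y s :
  P x -> P y -> runs P [:: x, y & s] =
  (x :: head [::] (runs P (y :: s))) :: behead (runs P (y :: s)).
Proof. by move=> Px Py; rewrite /runs /= Px Py. Qed.

Lemma runs_consF (T : Type) (P : pred T) x s :
  ~~ P x -> runs P (x :: s) = runs P s.
Proof. by move=> /negbTE Px; rewrite /runs /= Px. Qed.

Lemma runs_consTF (T : Type) (P : pred T) x y s :
  P x -> ~~ P y -> runs P [:: x, y & s] = [:: x] :: runs P (y :: s).
Proof. by move=> Px /negbTE Py; rewrite /runs /= Px Py. Qed.

Lemma runs_neq0 (T : Type) (P : pred T) x s : P x ->
  runs P (x :: s) = head [::] (runs P (x :: s)) :: behead (runs P (x :: s)).
Proof. by move=> Px; rewrite /runs /= Px. Qed.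

(** * Interleaving two lists of blocks *)

(** The natural recursion swaps the two lists, which is not structural; [inter_cons] recovers it. *)
Fixpoint inter (T : Type) (A B : seq (seq T)) : seq T :=
  if A is x :: A' then x ++ (if B is y :: B' then y ++ inter A' B' else [::])
  else [::].

Lemma inter_cons (T : Type) (x : seq T) A B : inter (x :: A) B = x ++ inter B A.
Proof.
rewrite /=; congr (_ ++ _); elim: A B x => [|z A IH] [|y B] x //=.
by rewrite -IH.
Qed.

(** The induction generalizes over [P]: when the next letter lies on the other side, [P] and
    [predC P] exchange roles. *)
Lemma inter_runs (T : eqType) (P : pred T) x s :
  P x -> inter (runs P (x :: s)) (runs (predC P) (x :: s)) = x :: s.
Proof.
elim: s P x => [|y s IH] P x Px; first by rewrite /runs /= Px.
rewrite [in X in inter _ X]runs_consF ?negbK //=.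
have [Py|Py] := boolP (P y).
  have := IH _ _ Py.
  by rewrite runs_consT // (runs_neq0 _ Py) !inter_cons /= => ->.
rewrite runs_consTF // inter_cons /=.
rewrite -[in RHS](IH (predC P) y Py); congr (_ :: inter _ _).
by apply: eq_in_runs => z _ /=; rewrite negbK.
Qed.

(** A nonempty block of [B] separates consecutive blocks of [A], which therefore do not merge. *)
Lemma runs_inter (T : eqType) (P : pred T) A B : size A = size B ->
    {in A, forall x, all P x && ~~ nilp x} ->
    {in B, forall x, all (predC P) x && ~~ nilp x} ->
  runs P (inter A B) = A.
Proof.
elim: A B => [|x A IH] [|y B] //= [AB] AP BP.
have /andP[xP x0] := AP x (mem_head _ _).
have /andP[yP y0] := BP y (mem_head _ _).
case: y BP yP y0 => [|z y] BP //= /andP[zP yP] _.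
rewrite runs_cat0 // runs_all // runs_none //= IH //.
  by move=> t tA; apply: AP; rewrite inE tA orbT.
by move=> t tA; apply: BP; rewrite inE tA orbT.
Qed.

Lemma inter_rcons (T : Type) (A B : seq (seq T)) x y : size A = size B ->
  inter (rcons A x) (rcons B y) = inter A B ++ x ++ y.
Proof.
elim: A B => [|a A IH] [|b B] //=; first by rewrite cats0.
by move=> [AB]; rewrite IH // -!catA.
Qed.

Lemma rev_inter (T : Type) (A B : seq (seq T)) : size A = size B ->
  rev (inter A B) = inter (rev (map rev B)) (rev (map rev A)).
Proof.
elim: A B => [|a A IH] [|b B] //= [AB].
rewrite !rev_cons inter_rcons ?size_rev ?size_map // -IH //.
by rewrite !rev_cat -catA.
Qed.

Lemma map_inter (T U : Type) (f : T -> U) (A B : seq (seq T)) :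
  map f (inter A B) = inter (map (map f) A) (map (map f) B).
Proof.
by elim: A B => [|a A IH] [|b B] //=; rewrite !map_cat //= IH.
Qed.

Lemma perm_inter (T : eqType) (A B : seq (seq T)) : size A = size B ->
  perm_eq (inter A B) (flatten A ++ flatten B).
Proof.
elim: A B => [|a A IH] [|b B] //= [AB].
by rewrite -catA perm_cat2l perm_sym perm_catCA perm_cat2l perm_sym IH.
Qed.

(** * Block lists and their insertion and merging steps *)

(** Odd length makes both ends local minima, so a larger letter can be put between two such
    blocks. *)
Definition valley_block (b : seq nat) : bool :=
  if b is x :: s then ~~ odd (size s) && alt ltn true x s else false.

(** The label counts the blocks left of [x]. A new block goes after [x], so the block of 0 always
    stays first. *)
Inductive step (i : nat) : bool * nat -> seq (seq nat) -> seq (seq nat) -> Prop :=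
| StepU A x B : step i (true, size A) (A ++ x :: B) (A ++ [:: x, [:: i] & B])
| StepD A x y B :
    step i (false, size A) (A ++ [:: x, y & B]) (A ++ (x ++ i :: y) :: B).

Inductive reach : seq (bool * nat) -> seq (seq nat) -> Prop :=
| Reach0 : reach [::] [:: [:: 0]]
| ReachS q mw bs bs' :
    reach q bs -> step (size q).+1 mw bs bs' -> reach (rcons q mw) bs'.

Lemma valley_block_merge i x y :
    valley_block x -> valley_block y -> {in x ++ y, forall z, z < i} ->
  valley_block (x ++ i :: y).
Proof.
case: x => [|a x] //; case: y => [|b y] //= /andP[ox ax] /andP[oy ay] lt_i.
have lx : last a x < i by apply: lt_i; rewrite -cat_cons mem_cat mem_last.
have ly : b < i by apply: lt_i; rewrite -cat_cons mem_cat mem_head orbT.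
by rewrite size_cat /= oddD /= negbK (negbTE ox) oy alt_cat ax (negbTE ox) /= lx ly ay.
Qed.

Lemma reach_inv q bs : reach q bs ->
  [/\ all valley_block bs, perm_eq (flatten bs) (iota 0 (size q).+1)
    & head 0 (head [::] bs) = 0].
Proof.
elim=> [|{}q mw {}bs bs' _ [vb pbs hbs] st]; first by split.
rewrite size_rcons -(addn1 (size q).+1) iotaD add0n.
have lt_bs z : z \in flatten bs -> z < (size q).+1.
  by rewrite (perm_mem pbs) mem_iota.
case: st vb pbs hbs lt_bs => [A x B|A x y B];
    rewrite !all_cat /= !flatten_cat /= => /and3P[vA vx].
  move=> vB pbs hbs _; split=> //; [by rewrite vA vx | | by case: A {vA pbs} hbs].
  apply/permP => p; move/permP: pbs => /(_ p).
  by rewrite !count_cat /= !count_cat /=; lia.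
move=> /andP[vy vB] pbs hbs lt_bs; split.
- rewrite vA vB andbT valley_block_merge // => z zxy.
  by apply: lt_bs; move: zxy; rewrite !mem_cat => /orP[]->; rewrite ?orbT.
- apply/permP => p; move/permP: pbs => /(_ p).
  by rewrite !count_cat /= !count_cat /=; lia.
- by case: A {vA pbs lt_bs} hbs => //=; case: x vx.
Qed.

(** Both [z] and [z'] are the first letter of the common word that satisfies [Q]. *)
Lemma cat_split_inj (T : Type) (Q : pred T) A z B A' z' B' :
    Q z -> Q z' -> all (predC Q) A -> all (predC Q) A' ->
  A ++ z :: B = A' ++ z' :: B' -> [/\ A = A', z = z' & B = B'].
Proof.
move=> Qz Qz'; elim: A A' => [|a A IH] [|a' A'] //=.
- by move=> _ _ [-> ->].
- by move=> _ /andP[Qa _] [E _]; rewrite -E Qz in Qa.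
- by move=> /andP[Qa _] _ [E _]; rewrite E Qz' in Qa.
by move=> /andP[_ QA] /andP[_ QA'] [<- /(IH _ QA QA')[-> -> ->]].
Qed.

(** The label fixes [size A], hence the place where [bs] is cut. *)
Lemma step_det i mw bs bs1 bs2 : step i mw bs bs1 -> step i mw bs bs2 -> bs1 = bs2.
Proof.
case=> [A x B|A x y B]; move E: (_, _) => m; move F: (_ ++ _) => b st;
    case: st E F => [A' x' B'|A' x' y' B'] [sA] // /eqP.
  by rewrite eqseq_cat // => /andP[/eqP-> /eqP[-> ->]].
by rewrite eqseq_cat // => /andP[/eqP-> /eqP[-> -> ->]].
Qed.

Lemma all_notin_block (i : nat) bs :
  i \notin flatten bs -> all (predC (fun b => i \in b)) bs.
Proof. by elim: bs => //= b bs IH; rewrite mem_cat negb_or => /andP[-> /IH]. Qed.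

(** [cat_split_inj] locates the block of [i] in [bs]. It is [[:: i]] after an insertion and longer
    after a merge, since no block is empty; in a merged block a second split, at [i] itself,
    separates [x] from [y]. *)
Lemma step_inj i mw1 mw2 bs1 bs2 bs :
    i \notin flatten bs1 -> i \notin flatten bs2 ->
    all (fun b => ~~ nilp b) bs1 -> all (fun b => ~~ nilp b) bs2 ->
    step i mw1 bs1 bs -> step i mw2 bs2 bs ->
  mw1 = mw2 /\ bs1 = bs2.
Proof.
move=> i1 i2 n1 n2 st1; case: st1 i1 n1 => [A x B|A x y B] i1 n1;
    move F: (_ ++ _) => b st2; case: st2 F i2 n2 => [A' x' B'|A' x' y' B'];
    move=> F /all_notin_block i2 n2; move/all_notin_block: i1 n1 n2 => i1;
    rewrite ?all_cat /=; move: i1 i2; rewrite !all_cat /=.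
- move=> /and3P[iA ix _] /and3P[iA' ix' _] _ _.
  move: F; rewrite -!(cat_rcons x) -!(cat_rcons x').
  case/(cat_split_inj (Q := fun b => i \in b));
    rewrite ?mem_head ?all_rcons /= ?ix ?ix' //.
  by case/rcons_inj=> -> -> _ ->.
- move=> /and3P[iA ix _] /and4P[iA' ix' iy' _] _ /and4P[_ x0 _ _].
  move: F; rewrite -(cat_rcons x).
  case/(cat_split_inj (Q := fun b => i \in b));
    rewrite ?mem_head ?all_rcons /= ?ix ?mem_cat ?mem_head ?orbT //.
  by case: x' x0 {ix'} => //= ? [].
- move=> /and4P[iA ix iy _] /and3P[iA' ix' _] /and4P[_ x0 _ _] _.
  move: F; rewrite -(cat_rcons x').
  case/(cat_split_inj (Q := fun b => i \in b));
    rewrite ?mem_head ?all_rcons /= ?ix' ?mem_cat ?mem_head ?orbT //.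
  by case: x x0 {ix} => //= ? [].
move=> /and4P[iA ix iy _] /and4P[iA' ix' iy' _] _ _.
case/(cat_split_inj (Q := fun b => i \in b)): F;
  rewrite ?mem_cat ?mem_head ?orbT // => -> F ->.
case/(cat_split_inj (Q := pred1 i)): F; rewrite /= ?eqxx //.
- by apply/allP=> z zx /=; apply: contraNneq ix => <-.
- by apply/allP=> z zx /=; apply: contraNneq ix' => <-.
by move=> -> _ ->.
Qed.

Lemma reach_det q bs1 bs2 : reach q bs1 -> reach q bs2 -> bs1 = bs2.
Proof.
move=> r1; elim: r1 bs2 => [|{}q mw bs bs' _ IH st] bs2.
  move E: (Nil (bool * nat)) => q' r2; case: r2 E => // - [] //.
move E: (rcons q mw) => q' r2.
case: r2 E st => [|q2 mw2 b b' r2 st2]; first by case: q {IH}.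
by case/rcons_inj=> Eq Em; move: r2 st2; rewrite -Eq -Em => /IH<- st2 /step_det; apply.
Qed.

Lemma reach_nonnil q bs : reach q bs -> all (fun b => ~~ nilp b) bs.
Proof. by case/reach_inv=> vb _ _; apply: sub_all vb => -[]. Qed.

Lemma reach_fresh q bs : reach q bs -> (size q).+1 \notin flatten bs.
Proof. by case/reach_inv=> _ /perm_mem-> _; rewrite mem_iota ltnn. Qed.

Lemma reach_inj q1 q2 bs :
  size q1 = size q2 -> reach q1 bs -> reach q2 bs -> q1 = q2.
Proof.
move=> + r1; elim: r1 q2 => [|{}q1 mw b b' r1 IH st] q2; first by case: q2.
rewrite size_rcons => + r2; case: r2 st => [|{}q2 mw2 c c' r2 st2] // st.
rewrite size_rcons => -[E]; rewrite -E in st2.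
have c_fresh : (size q1).+1 \notin flatten c by rewrite E (reach_fresh r2).
have [-> bc] := step_inj (reach_fresh r1) c_fresh (reach_nonnil r1) (reach_nonnil r2) st st2.
by rewrite (IH q2) // bc.
Qed.

(** * Heights and the ballot conditions *)

Lemma height_rcons P b i : i <= size P -> height (rcons P b) i = height P i.
Proof. by move=> le_i; rewrite /height -cats1 takel_cat. Qed.

Lemma height_rcons_size P b :
  height (rcons P b) (size P).+1 =
  (height P (size P) + (if b then 1 else - 1))%R.
Proof.
rewrite /height -(size_rcons P b) !take_size -cats1 !count_cat.
by case: b => /=; lia.
Qed.

Lemma is_ballot_rcons n m b w v : size m = n -> size w = n ->
  is_ballot n.+1 (rcons m b, rcons w v) =
  [&& is_ballot n (m, w), (0 <= height (rcons m b) n.+1)%R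
    & (v%:Z <= height m n - (~~ b)%:Z)%R].
Proof.
move=> sm sw; rewrite /is_ballot ![fst _]/= ![snd _]/= !size_rcons sm sw !eqxx.
have iota_rcons k : iota 0 k.+1 = iota 0 k ++ [:: k] by rewrite -addn1 iotaD.
rewrite (iota_rcons n.+1) all_cat all_seq1.
have -> : all (fun i => (0 <= height (rcons m b) i)%R) (iota 0 n.+1) =
          all (fun i => (0 <= height m i)%R) (iota 0 n.+1).
  by apply: eq_in_all => i; rewrite mem_iota add0n => /andP[_ le_i]; rewrite height_rcons ?sm.
set F := all _ (iota 0 n.+1); set G := all _ (iota 0 n.+1); set H := all _ (iota 0 n).
have -> : G = H && (v%:Z <= height m n - (~~ b)%:Z)%R.
  rewrite /G iota_rcons all_cat all_seq1 !nth_rcons sm sw ltnn eqxx.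
  rewrite height_rcons ?sm //; congr (_ && _).
    apply: eq_in_all => i; rewrite mem_iota add0n => /andP[_ lt_i].
    by rewrite !nth_rcons sm sw lt_i height_rcons // sm ltnW.
  by case: (b); rewrite ?GRing.subr0.
by clearbody F H; rewrite !andTb -!andbA; congr (_ && _); rewrite andbCA.
Qed.

(** [StepU] needs one block beyond [A] and [StepD] needs two; with one block more than the height,
    these are the two label bounds. *)
Lemma reach_ballot q bs : reach q bs ->
  is_ballot (size q) (unzip1 q, unzip2 q) /\
  ((size bs)%:Z = height (unzip1 q) (size q) + 1)%R.
Proof.
elim=> [|{}q mw {}bs bs' _ [qb sbs] st] //.
rewrite /unzip1 /unzip2 !map_rcons size_rcons is_ballot_rcons ?size_map // qb /=.
have := height_rcons_size (unzip1 q) mw.1; rewrite size_map => ->.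
by case: st sbs => [A x B|A x y B] /=; rewrite !size_cat -/(unzip1 q) /=; split; lia.
Qed.

Lemma ballot_reach n m w : is_ballot n (m, w) -> exists bs, reach (zip m w) bs.
Proof.
elim: n m w => [|n IH] m w qb; have /and4P[/= /eqP sm /eqP sw _ _] := qb.
  by case: m w sm sw {qb} => [|//] [|//] _ _; exists [:: [:: 0]]; constructor.
case/lastP: m => [|m b] // in sm qb *; case/lastP: w => [|w v] // in sw qb *.
move: sm sw; rewrite !size_rcons => -[sm] [sw].
move: qb; rewrite is_ballot_rcons // => /and3P[/IH[bs r] h0 hv].
rewrite zip_rcons ?sm //.
have [_] := reach_ballot r; rewrite unzip1_zip ?size_zip ?sm ?sw // minnn => sbs.
move: h0; rewrite -sm height_rcons_size sm => h0.
case: b h0 hv => /= h0 hv; have v_lt : v < size bs by lia.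
  exists (take v bs ++ [:: nth [::] bs v, [:: (size (zip m w)).+1] & drop v.+1 bs]).
  apply: (ReachS r); rewrite -{1}(cat_take_drop v bs) (drop_nth [::]) //.
  by rewrite -{1}(size_takel (ltnW v_lt)); constructor.
(* A D step merges the blocks of indices [v] and [v.+1]; both exist because [v] is at most the
   height minus 1. *)
have v1_lt : v.+1 < size bs by lia.
eexists; apply: (ReachS r); rewrite -{1}(cat_take_drop v bs).
rewrite (drop_nth [::]) // (drop_nth [::] v1_lt).
by rewrite -{1}(size_takel (ltnW v_lt)); constructor.
Qed.

(** * How one letter changes the runs *)

(** The count of [Psi_w], written by recursion on the word to be compared with [runs]. *)
Fixpoint crossings (i x : nat) (s : seq nat) : nat :=
  if s is y :: s' then ((y < i) && (i < x)) + crossings i y s' else 0.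

Lemma count_crossings i x s :
  count (fun k => (nth 0 (x :: s) k.+1 < i) && (i < nth 0 (x :: s) k))
    (iota 0 (size s)) = crossings i x s.
Proof.
elim: s x => [|y s IH] x //=; rewrite -IH (iotaDl 1 0) count_map.
by congr (_ + _); apply: eq_count => k.
Qed.

(** A run below [i] either starts the word or is entered by a descent across [i]; as [i] does not
    occur, all letters outside the runs are above [i]. *)
Lemma size_runs_crossings i x s : i \notin x :: s ->
  size (runs (ltn^~ i) (x :: s)) = (x < i) + crossings i x s.
Proof.
elim: s x => [|y s IH] x; rewrite in_cons negb_or => /andP[ix iys].
  by rewrite /runs /=; case: (x < i).
have [xi|xi] := boolP (x < i); last first.
  rewrite runs_consF // IH //= andbC.
  by have -> : i < x by rewrite ltn_neqAle ix leqNgt xi.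
rewrite /= (ltnNge i x) (ltnW xi) andbF add0n.
have [yi|yi] := boolP (y < i).
  rewrite runs_consT // /=; have := IH y iys.
  by rewrite (runs_neq0 (P := ltn^~ i)) //= yi.
by rewrite runs_consTF //= IH // (negbTE yi).
Qed.

Lemma extE s k : k <= size s -> ext s k = nth 0 (0 :: s) k.
Proof. by case: k => [|k] //=; rewrite /ext /= => ->. Qed.

Lemma Psi_w_cat i a b : i \notin a -> Psi_w (a ++ i :: b) i = crossings i 0 a.
Proof.
move=> ia; rewrite /Psi_w index_cat (negbTE ia) /= eqxx addn0 -count_crossings.
rewrite (iotaDl 1 0) count_map; apply: eq_in_count => k.
rewrite mem_iota add0n => /andP[_ lt_k] /=.
have le_a : size a <= size (a ++ i :: b) by rewrite size_cat leq_addr.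
rewrite !extE ?(leq_trans _ le_a) //=; last by rewrite ltnW.
by rewrite nth_cat lt_k -cat_cons nth_cat ltnS (ltnW lt_k).
Qed.

(** The default of [head] is the infinite letter closing the word. *)
Lemma Psi_m_cat i a b : i \notin a ->
  Psi_m (a ++ i :: b) i =
  (i < last 0 a) && (i < head (foldr maxn 0 (a ++ i :: b)).+1 b).
Proof.
move=> ia; rewrite /Psi_m index_cat (negbTE ia) /= eqxx addn0.
rewrite extE ?size_cat ?leq_addr ?addnS ?ltnS ?leq_addr //.
rewrite extE ?size_cat ?leq_addr ?addnS ?ltnS ?leqW ?leq_addr //.
have -> : nth 0 (0 :: a ++ i :: b) (size a).+1 = i.
  by rewrite /= nth_cat ltnn subnn.
have -> : nth 0 (0 :: a ++ i :: b) (size a) = last 0 a.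
  by rewrite -cat_cons nth_cat ltnS leqnn -[in RHS]nth_last; case: a {ia} => [|x a].
congr (_ && (_ < _)); rewrite /ext /= size_cat /= addnS ltnS.
by case: b => [|y b] /=; rewrite ?addn0 ?ltnn // addnS ltnS leq_addr nth_cat ltnNge leqnSn subSnn.
Qed.

(** Admitting [i] changes the runs only around [i]: a peak joins its two neighbouring runs, a valley
    becomes a run by itself. In both cases [x] is the last run of [0 :: a], and the crossings count
    the runs before it. *)
Lemma step_runs i a z b : 0 < i -> i \notin a -> i \notin z :: b ->
    alt ltn true 0 (a ++ [:: i, z & b]) ->
  step i ((i < last 0 a) && (i < z), crossings i 0 a)
    (runs (ltn^~ i) (0 :: a ++ [:: i, z & b]))
    (runs (leq^~ i) (0 :: a ++ [:: i, z & b])).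
Proof.
move=> i0 ia izb; rewrite alt_cat => /andP[_].
have i0a : i \notin 0 :: a by rewrite in_cons negb_or ia -lt0n i0.
have cE : size (runs (ltn^~ i) (0 :: a)) = (crossings i 0 a).+1.
  by rewrite size_runs_crossings // i0.
rewrite -[0 :: a ++ _]/((0 :: a) ++ _); move: cE.
set P := ltn^~ i; set Q := leq^~ i => cE.
have eqQP (s : seq nat) : i \notin s -> {in s, Q =1 P}.
  move=> nis y ys; rewrite /Q /P /= leq_eqVlt.
  by case: eqP => // yi; rewrite -yi ys in nis.
have Pi : ~~ P i by rewrite /P /= ltnn.
have Qi : Q i by apply: leqnn.
(* An ascent into [i] makes it a peak, a descent makes it a valley. *)
case: (_ (+) _) => /and3P[].
  move=> li zi _; rewrite (ltnNge i) (ltnW li) andFb.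
  have [A [u [aE wE]]] := splits_catP Q (0 :: a) [:: i, z & b].
  rewrite (eq_in_splits (eqQP _ i0a)) in aE.
  have ibE : splits Q [:: i, z & b] =
      (i :: head [::] (splits P (z :: b))) :: behead (splits P (z :: b)).
    by rewrite -(eq_in_splits (eqQP _ izb)) [LHS]/= Qi.
  rewrite {}ibE [head _ _]/= [behead _]/= in wE.
  (* Both neighbours of the peak are below [i], so the pieces on its two sides are nonempty and
     count as runs. *)
  have u0 : ~~ nilp u.
    by rewrite lastI in aE; rewrite (nilp_last_splits aE) negbK.
  have v0 : ~~ nilp (head [::] (splits P (z :: b))).
    by rewrite nilp_head_splits negbK.
  rewrite /runs (splits_cat0 _ _ Pi) aE filter_cat filter_rcons u0.
  rewrite wE filter_cat (splits_cons P (z :: b)) [filter _ (_ :: _)]/= v0.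
  move: cE; rewrite /runs aE filter_rcons u0 size_rcons => -[<-].
  have w0 v : ~~ nilp (u ++ i :: v) by rewrite /nilp size_cat addnS.
  by rewrite [filter _ ((u ++ _) :: _)]/= w0 cat_rcons; constructor.
move=> il iz _; have -> : (i < last 0 a) && (i < z) by apply/andP.
case/lastP: a => [|a y] // in ia i0a cE il *.
rewrite last_rcons in il; rewrite -rcons_cons cat_rcons.
have Py : ~~ P y by rewrite -leqNgt ltnW.
have Pz : ~~ P z by rewrite -leqNgt ltnW.
have Qy : ~~ Q y by rewrite -ltnNge.
have Qz : ~~ Q z by rewrite -ltnNge.
have i0a' : i \notin 0 :: a.
  by apply: contra i0a; rewrite -rcons_cons mem_rcons in_cons => ->; rewrite orbT.
have ib : i \notin b by apply: contra izb; rewrite in_cons => ->; rewrite orbT.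
rewrite !runs_cat0 // !(runs_consF _ Pi) (runs_consF _ Pz).
rewrite runs_consTF // (runs_consF _ Qz).
rewrite (eq_in_runs (eqQP _ i0a')) (eq_in_runs (eqQP _ ib)).
move: cE; rewrite -rcons_cons -cats1 runs_cat0 // cats0.
case/lastP: (runs _ (0 :: a)) => [|A x] //; rewrite size_rcons => -[<-].
by rewrite !cat_rcons; constructor.
Qed.

(** * Reverse-complement and the runs of a padded permutation *)

Definition compl (n x : nat) : nat := (2 * n).+1 - x.

Definition rc (n : nat) (s : seq nat) : seq nat := map (compl n) (rev s).

(** The sentinels 0 and 2n+1 are complementary, so padding preserves invariance under [rc]. *)
Definition padded (n : nat) (s : seq nat) : seq nat := 0 :: rcons s (2 * n).+1.

(** The ascent from 0 makes the first step inside [s] a descent; as 2n is even, the step to 2n+1 is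
    again an ascent. *)
Definition rc_alt (n : nat) (s : seq nat) : Prop :=
  [/\ perm_eq s (iota 1 (2 * n)), alt ltn true 0 (rcons s (2 * n).+1)
    & rc n s = s].

Lemma foldr_maxn_iota n s : perm_eq s (iota 1 n) -> foldr maxn 0 s = n.
Proof.
move=> ps; have le_max x : x \in s -> x <= foldr maxn 0 s.
  elim: s {ps} => //= y s IH; rewrite in_cons leq_max.
  by case/orP=> [/eqP->|/IH->]; rewrite ?leqnn ?orbT.
apply/eqP; rewrite eqn_leq; apply/andP; split.
  have : {in s, forall x, x <= n} by move=> x; rewrite (perm_mem ps) mem_iota; lia.
  elim: s {ps le_max} => //= y s IH le_n; rewrite geq_max le_n ?mem_head //=.
  by apply: IH => x xs; rewrite le_n // in_cons xs orbT.
case: n ps => // n ps; apply: le_max; rewrite (perm_mem ps) mem_iota; lia.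
Qed.

Lemma runs_single (T : Type) (P : pred T) x s :
  P x -> all (predC P) s -> runs P (x :: s) = [:: [:: x]].
Proof.
case: s => [|y s] Px; first by rewrite /runs /= Px.
move=> /[dup] /andP[Py _] Ps; rewrite runs_consTF //.
by rewrite -[y :: s]cats0 runs_none.
Qed.

Lemma reach_Psi n s k :
    perm_eq s (iota 1 (2 * n)) -> alt ltn true 0 (rcons s (2 * n).+1) ->
    k <= 2 * n ->
  reach [seq (Psi_m s i, Psi_w s i) | i <- iota 1 k]
    (runs (leq^~ k) (padded n s)).
Proof.
move=> ps alts; elim: k => [|k IH] lekn.
  rewrite runs_single //; first by constructor.
  rewrite all_rcons /=; apply/allP => x; rewrite (perm_mem ps) mem_iota /=; lia.
have -> : iota 1 k.+1 = rcons (iota 1 k) k.+1 by rewrite -[in LHS](addn1 k) iotaD add1n cats1.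
rewrite map_rcons; apply: ReachS (IH (ltnW lekn)) _.
have /splitPr : k.+1 \in s by rewrite (perm_mem ps) mem_iota; lia.
(* The infinite letter of [ext] is the maximum plus one, which is exactly the sentinel 2n+1. *)
rewrite size_map size_iota; move: (foldr_maxn_iota ps) => maxE.
have us : uniq s by rewrite (perm_uniq ps) iota_uniq.
have sN : (2 * n).+1 \notin s by rewrite (perm_mem ps) mem_iota; lia.
move=> sE; case: sE alts us maxE sN => a b alts us maxE sN.
move: us; rewrite cat_uniq /= negb_or => /and4P[_ /andP[ka _] kb _].
rewrite Psi_m_cat // Psi_w_cat // maxE.
move: sN alts; rewrite /padded mem_cat in_cons !negb_or => /and3P[_ kN _].
rewrite rcons_cat rcons_cons.
have : k.+1 \notin rcons b (2 * n).+1.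
  by rewrite mem_rcons in_cons negb_or kb eq_sym kN.
have -> : head (2 * n).+1 b = head 0 (rcons b (2 * n).+1) by case: b {kb maxE}.
case: (rcons b _) (size_rcons b (2 * n).+1) => // z b' _ kzb alts.
have := step_runs (ltn0Sn k) ka kzb alts.
by rewrite (eq_in_runs (Q := leq^~ k)).
Qed.

Lemma complK n x : x <= (2 * n).+1 -> compl n (compl n x) = x.
Proof. by rewrite /compl; lia. Qed.

Lemma ltn_compl n x y : x <= (2 * n).+1 -> y <= (2 * n).+1 ->
  (compl n x < compl n y) = (y < x).
Proof. by rewrite /compl; lia. Qed.

Lemma rcK n s : {in s, forall x, x <= (2 * n).+1} -> rc n (rc n s) = s.
Proof.
move=> les; rewrite /rc -map_rev revK -map_comp -[RHS]map_id.
by apply/eq_in_map => x xs /=; rewrite complK ?les.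
Qed.

Lemma alt_compl n up x s : {in x :: s, forall y, y <= (2 * n).+1} ->
  alt ltn up (compl n x) (map (compl n) s) = alt ltn (~~ up) x s.
Proof.
move=> les; rewrite -alt_converse; apply: alt_map => a b aP bP.
by apply: ltn_compl; apply: les.
Qed.

(** Complementing flips every comparison, and reversal shifts the direction by the parity from
    [alt_rev]. *)
Lemma alt_rc n up x s : {in x :: s, forall y, y <= (2 * n).+1} ->
  exists y t, rc n (x :: s) = y :: t /\
    alt ltn up y t = alt ltn (up (+) ~~ odd (size s)) x s.
Proof.
move=> les; exists (compl n (last x s)), (map (compl n) (rev (belast x s))).
split; first by rewrite /rc lastI rev_rcons.
rewrite alt_compl => [|y]; last by rewrite -rev_rcons -lastI mem_rev; apply: les.
by rewrite -[RHS]alt_rev addbN addNb -addbA addbb addbF.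
Qed.

Lemma mem_padded n s x : perm_eq s (iota 1 (2 * n)) ->
  x \in padded n s -> x <= (2 * n).+1.
Proof.
by move=> ps; rewrite in_cons mem_rcons in_cons (perm_mem ps) mem_iota; lia.
Qed.

Lemma rc_padded n s : rc n s = s -> rc n (padded n s) = padded n s.
Proof.
rewrite /rc /padded rev_cons rev_rcons -!cats1 /= map_cat /= => ->.
by rewrite /compl subnn subn0.
Qed.

(** [compl] exchanges the letters up to [n] with those above [n]. *)
Lemma runs_rc n s : {in s, forall x, x <= (2 * n).+1} ->
  runs (predC (leq^~ n)) (rc n s) = rev (map (rc n) (runs (leq^~ n) s)).
Proof.
move=> les; rewrite /rc runs_map runs_rev map_rev -map_comp; congr (rev (map _ _)).
by apply: eq_in_runs => x /les; rewrite /= /compl; lia.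
Qed.

(** By [runs_rc] the low runs determine the high ones, and [inter_runs] reassembles the word since
    it starts with the low letter 0. *)
Lemma rc_alt_inj n s1 s2 : rc_alt n s1 -> rc_alt n s2 ->
  runs (leq^~ n) (padded n s1) = runs (leq^~ n) (padded n s2) -> s1 = s2.
Proof.
move=> [ps1 _ rc1] [ps2 _ rc2] E.
have inj_rcons : padded n s1 = padded n s2 -> s1 = s2 by case=> /rcons_inj[].
apply: inj_rcons.
rewrite -[LHS](inter_runs (P := leq^~ n)) // -[RHS](inter_runs (P := leq^~ n)) //.
rewrite -[0 :: rcons s1 _]/(padded n s1) -[0 :: rcons s2 _]/(padded n s2) E.
congr inter; rewrite -(rc_padded rc1) -(rc_padded rc2) !runs_rc ?E //.
  by move=> x; apply: mem_padded.
by move=> x; apply: mem_padded.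
Qed.

(** * Rebuilding a permutation from its blocks *)

Definition peak_block (b : seq nat) : bool :=
  if b is x :: s then ~~ odd (size s) && alt ltn false x s else false.

Lemma peak_block_rc n b : {in b, forall x, x <= (2 * n).+1} ->
  valley_block b -> peak_block (rc n b).
Proof.
case: b => // x s les /andP[os alts].
have [y [t [E /= altE]]] := alt_rc false les.
have st : size t = size s by have := congr1 size E; rewrite size_map size_rev => -[].
by rewrite E /= st os altE /= os.
Qed.

Definition zigzag (s : seq nat) : bool :=
  if s is x :: s' then alt ltn true x s' else true.

(** Odd block lengths keep the directions in phase: the step out of a valley block must ascend, the
    step out of a peak block must descend, and both do because [A] lies below [B]. *)
Lemma zigzag_inter A B : size A = size B ->
    all valley_block A -> all peak_block B ->
    {in flatten A & flatten B, forall x y, x < y} ->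
  zigzag (inter A B).
Proof.
elim: A B => [|[|x a] A IH] [|[|y b] B] //= [AB]; rewrite ?andbF //.
move=> /andP[/andP[oa xa] vA] /andP[/andP[ob yb] pB] ltAB.
have altAB : zigzag (inter A B).
  apply: IH => // u v uA vB.
  by apply: ltAB; rewrite ?in_cons mem_cat ?uA ?vB !orbT.
rewrite alt_cat xa (negbTE oa) /= alt_cat yb (negbTE ob) /=.
rewrite ltAB /= -?cat_cons ?mem_cat ?mem_last ?mem_head //.
case: A {AB IH} vA ltAB altAB => [|[|z a'] A] //= _ ltAB ->.
rewrite andbT ltAB // -?cat_cons ?mem_cat ?mem_last //.
by rewrite mem_head orbT.
Qed.

Lemma rc_alt_of_blocks n q bs : size q = n -> reach q bs ->
  exists2 s, rc_alt n s & runs (leq^~ n) (padded n s) = bs.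
Proof.
move=> sq r; have [vb pb hb] := reach_inv r; rewrite sq in pb.
have le_bs x : x \in flatten bs -> x <= n by rewrite (perm_mem pb) mem_iota.
have le_b b : b \in bs -> {in b, forall x, x <= n}.
  by move=> bB x xb; apply: le_bs; apply/flattenP; exists b.
have le2_b b : b \in bs -> {in b, forall x, x <= (2 * n).+1}.
  by move=> bB x /(le_b _ bB); lia.
(* [F] is the word with its sentinels, which are stripped at the end. *)
pose hs := rev (map (rc n) bs); pose F := inter bs hs.
have szh : size bs = size hs by rewrite size_rev size_map.
have hsP b : b \in hs -> exists2 b', b' \in bs & b = rc n b'.
  by rewrite mem_rev => /mapP.
have gt_hs x : x \in flatten hs -> n < x.
  case/flattenP=> b /hsP[b' b'B ->] /mapP[y]; rewrite mem_rev => /(le_b _ b'B) le_y ->.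
  by rewrite /compl; lia.
have runsF : runs (leq^~ n) F = bs.
  apply: runs_inter => // b.
    move=> bB; apply/andP; split; first by apply/allP => x /(le_b _ bB).
    by have /allP/(_ _ bB) := reach_nonnil r.
  move=> bH; apply/andP; split.
    by apply/allP => x xb /=; rewrite -ltnNge gt_hs //; apply/flattenP; exists b.
  have [b' b'B ->] := hsP _ bH; rewrite /nilp size_map size_rev.
  by have /allP/(_ _ b'B) := reach_nonnil r.
have rcF : rc n F = F.
  rewrite /rc rev_inter // map_inter; congr inter.
    rewrite /hs !map_rev revK -!map_comp -[RHS]map_id.
    by apply/eq_in_map => b bB /=; rewrite -[LHS]/(rc n (rc n b)) rcK //; apply: le2_b.
  by rewrite /hs !map_rev -map_comp.
have altF : zigzag F.
  apply: zigzag_inter => //.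
    by apply/allP => b /hsP[b' b'B ->]; apply: peak_block_rc (le2_b _ b'B) _; apply: (allP vb).
  by move=> x y /le_bs le_x /gt_hs; apply: leq_ltn_trans.
(* The blocks of [bs] hold 0 to n; their complements are n+1 to 2n+1. *)
have pF : perm_eq F (iota 0 (2 * n).+2).
  apply: perm_trans (perm_inter szh) _.
  have -> : (2 * n).+2 = n.+1 + n.+1 by lia.
  rewrite iotaD; apply: perm_cat => //.
  have ph : perm_eq (flatten hs) (map (compl n) (flatten bs)).
    rewrite map_flatten /hs; apply: perm_trans (perm_flatten _) _.
      by rewrite perm_rev.
    elim: (bs) => //= b bs' IH; apply: perm_cat => //.
    by apply: perm_map; rewrite perm_rev.
  apply: perm_trans ph _; apply: perm_trans (perm_map _ pb) _.
  apply: uniq_perm; rewrite ?iota_uniq ?map_inj_in_uniq ?iota_uniq //.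
    by move=> x y; rewrite !mem_iota /compl; lia.
  move=> x; apply/mapP/idP => [[y]|]; rewrite mem_iota.
    by move=> y_le ->; rewrite mem_iota /compl; lia.
  by move=> x_le; exists (compl n x); rewrite ?mem_iota /compl; lia.
have [t FE] : exists t, F = 0 :: t.
  rewrite /F; case: (bs) vb hb (perm_size pb) => [|[|x b] bs'] //= _ -> _.
  by eexists.
rewrite FE in pF rcF altF runsF.
case/lastP: t => [|s z] in pF rcF altF runsF {FE}; first by [].
(* Invariance makes the last letter the complement of the first, which is 0. *)
have [sE zE] : rc n s = s /\ z = (2 * n).+1.
  move: rcF; rewrite /rc rev_cons rev_rcons -cats1 map_cat /= cats1.
  by case=> _ /rcons_inj[-> <-]; rewrite /compl subn0.
rewrite zE in pF altF runsF; exists s => //; split=> //.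
move: pF; rewrite -(addn1 (2 * n).+1) iotaD /= add0n perm_cons -cats1.
by rewrite perm_cat2r.
Qed.

(** * Snakes as halves of rc-invariant permutations *)

Definition untilde (n v : nat) : int :=
  if n < v then Posz (v - n) else (- Posz (n.+1 - v))%R.

(* [flip] absorbs the parity distinction in [psi]: see [psiE]. *)
Definition flip (n v : nat) : nat := if odd n then compl n v else v.

(** For either parity the last [n] entries follow the order of the snake; for odd [n] they are
    complemented, which [flip] undoes. *)
Definition unpsi (n : nat) (s : seq nat) : seq int :=
  map (untilde n \o flip n) (drop n s).

Lemma tildeK n x : 0 < absz x <= n -> untilde n (tilde n x) = x.
Proof. by rewrite /tilde; case: ifP => ?; rewrite /untilde; case: ifP => ?; lia. Qed.

Lemma untildeK n v : 0 < v <= 2 * n -> tilde n (untilde n v) = v.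
Proof. by rewrite /untilde; case: ifP => ?; rewrite /tilde; case: ifP => ?; lia. Qed.

Lemma tilde_bounds n x : 0 < absz x <= n -> 0 < tilde n x <= 2 * n.
Proof. by rewrite /tilde; case: ifP => ?; lia. Qed.

Lemma absz_untilde n v : 0 < v <= 2 * n -> 0 < absz (untilde n v) <= n.
Proof. by rewrite /untilde; case: ifP => ?; lia. Qed.

(** Complementing a letter changes the sign of the snake entry. *)
Lemma absz_untilde_compl n v : 0 < v <= 2 * n ->
  absz (untilde n (compl n v)) = absz (untilde n v).
Proof. by rewrite /untilde /compl; do 2 case: ifP => ?; lia. Qed.

Lemma absz_untilde_inj n u v : 0 < u <= 2 * n -> 0 < v <= 2 * n ->
  absz (untilde n u) = absz (untilde n v) -> u = v \/ u = compl n v.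
Proof. by rewrite /untilde /compl; do 2 case: ifP => ?; lia. Qed.

Lemma ltn_tilde n x y : 0 < absz x <= n -> 0 < absz y <= n ->
  (tilde n x < tilde n y) = (x < y)%R.
Proof. by rewrite /tilde; do 2 case: ifP => ?; lia. Qed.

Lemma flipK n v : v <= (2 * n).+1 -> flip n (flip n v) = v.
Proof. by rewrite /flip; case: (odd n) => //; apply: complK. Qed.

Lemma flip_bounds n v : 0 < v <= 2 * n -> 0 < flip n v <= 2 * n.
Proof. by rewrite /flip /compl; case: ifP => _; lia. Qed.

Lemma psiE n p : {in p, forall x, 0 < absz x <= n} ->
  let t := map (flip n \o tilde n) p in psi n p = rc n t ++ t.
Proof.
move=> bp /=; rewrite /psi /rc /flip; case: (odd n).
  rewrite revK -!map_rev -!map_comp; congr (_ ++ _); apply/eq_in_map => x.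
  by rewrite mem_rev => /bp/tilde_bounds /= bx; rewrite complK //; lia.
by congr (_ ++ _).
Qed.

Lemma psiK n p : size p = n -> {in p, forall x, 0 < absz x <= n} ->
  unpsi n (psi n p) = p.
Proof.
move=> sp bp; rewrite psiE // /unpsi drop_size_cat; last first.
  by rewrite size_map size_rev size_map.
rewrite -map_comp -[RHS]map_id; apply/eq_in_map => x /bp /= bx.
by rewrite flipK ?tildeK //; have := tilde_bounds bx; lia.
Qed.

Lemma unpsiK n s : rc_alt n s -> psi n (unpsi n s) = s.
Proof.
case=> ps _ rcs.
have bs x : x \in drop n s -> 0 < x <= 2 * n.
  by move/mem_drop; rewrite (perm_mem ps) mem_iota; lia.
have ss : size s = 2 * n by rewrite (perm_size ps) size_iota.
rewrite psiE => [|_ /mapP[x /bs bx ->]] /=; last first.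
  by apply: absz_untilde; apply: flip_bounds.
have -> : map (flip n \o tilde n) (unpsi n s) = drop n s.
  rewrite -map_comp -[RHS]map_id; apply/eq_in_map => x /bs bx /=.
  by rewrite untildeK ?flip_bounds // flipK //; lia.
rewrite -[in RHS](cat_take_drop n s); congr (_ ++ _).
rewrite -[in RHS]rcs /rc -map_take take_rev ss.
by congr (map _ (rev (drop _ _))); lia.
Qed.

Lemma map_uniq_inj_in (T U : eqType) (f : T -> U) s :
  uniq (map f s) -> {in s &, injective f}.
Proof.
elim: s => //= z s IH /andP[fz us] x y; rewrite !in_cons.
case/orP=> [/eqP->|xs] /orP[/eqP->|ys] // E; last exact: IH.
  by case/negP: fz; rewrite E map_f.
by case/negP: fz; rewrite -E map_f.
Qed.

(** Letters of equal absolute value form a pair v, 2n+1-v. Both sides say that [t] takes exactly one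
    letter from each pair; [uniq_min_size] turns distinctness into a permutation. *)
Lemma perm_rc_cat n t : size t = n -> {in t, forall x, 0 < x <= 2 * n} ->
  perm_eq (rc n t ++ t) (iota 1 (2 * n)) =
  perm_eq (map (absz \o untilde n) t) (iota 1 n).
Proof.
move=> st bt.
have mem_rc x : x \in t -> compl n x \in rc n t.
  by move=> xt; apply: map_f; rewrite mem_rev.
apply/idP/idP => pt.
  have : uniq (rc n t ++ t) by rewrite (perm_uniq pt) iota_uniq.
  rewrite cat_uniq => /and3P[_ /hasPn disj ut].
  have u1 : uniq (map (absz \o untilde n) t).
    rewrite map_inj_in_uniq // => x y xt yt /= /absz_untilde_inj[]; rewrite ?bt //.
    by move=> xE; have := disj x xt; rewrite xE mem_rc.
  have [||_ eqm] := uniq_min_size u1 (s2 := iota 1 n).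
  - by move=> _ /mapP[x /bt /absz_untilde /= bx ->]; rewrite mem_iota; lia.
  - by rewrite size_iota size_map st.
  by apply: uniq_perm; rewrite ?iota_uniq.
have u1 : uniq (map (absz \o untilde n) t) by rewrite (perm_uniq pt) iota_uniq.
have inj : {in t &, injective (absz \o untilde n)} by exact: map_uniq_inj_in.
have u2 : uniq (rc n t ++ t).
  rewrite cat_uniq (map_uniq u1) andbT map_inj_in_uniq ?rev_uniq ?(map_uniq u1) /=.
    apply/hasPn => x xt; apply/negP => /mapP[y]; rewrite mem_rev => yt xE.
    have := inj x y xt yt; rewrite /= xE absz_untilde_compl ?bt // => /(_ erefl).
    by have := bt y yt; rewrite /compl; lia.
  by move=> x y; rewrite !mem_rev /compl => /bt ? /bt ?; lia.
have [||_ eqm] := uniq_min_size u2 (s2 := iota 1 (2 * n)).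
- move=> x; rewrite mem_cat mem_iota => /orP[/mapP[y]|/bt]; last by lia.
  by rewrite mem_rev /compl => /bt ? ->; lia.
- by rewrite size_iota size_cat size_map size_rev st; lia.
by apply: uniq_perm; rewrite ?iota_uniq.
Qed.

(** The two halves alternate together by [alt_rc], and the comparisons with the sentinels always
    hold. The middle comparison, of [compl n x] with [x], becomes [n < flip n x]: the snake starts
    with a positive entry. *)
Lemma alt_rc_cat n x t : size t = n.-1 -> 0 < n ->
    {in x :: t, forall y, 0 < y <= 2 * n} ->
  alt ltn true 0 (rcons (rc n (x :: t) ++ x :: t) (2 * n).+1) =
  (n < flip n x) && alt ltn false (flip n x) (map (flip n) t).
Proof.
move=> st n0 bt.
have le_t : {in x :: t, forall y, y <= (2 * n).+1} by move=> y /bt; lia.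
have bl : 0 < last x t <= 2 * n by apply/bt/mem_last.
have ot : odd (size t) = ~~ odd n by rewrite st -[in RHS](prednK n0) /= negbK.
have flipE : alt ltn false (flip n x) (map (flip n) t) = alt ltn (odd n) x t.
  rewrite /flip; case: (odd n); first by rewrite alt_compl.
  by rewrite map_id.
have srt : size (rc n (x :: t)) = n by rewrite size_map size_rev /= st prednK.
have last_rc : last 0 (rc n (x :: t)) = compl n x by rewrite /rc rev_cons map_rcons last_rcons.
rewrite flipE -cats1 -catA alt_cat srt last_rc.
have [y [u [rcE altE]]] := alt_rc false le_t.
have -> : alt ltn true 0 (rc n (x :: t)) = alt ltn (odd n) x t.
  rewrite rcE /= altE ot negbK.
  have : y \in rc n (x :: t) by rewrite rcE mem_head.
  by case/mapP=> z; rewrite mem_rev => /bt bz ->; rewrite /compl subn_gt0 (_ : z < _) //; lia.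
rewrite /= alt_cat ot /=.
have -> : ~~ (true (+) odd n) (+) ~~ odd n = true by case: (odd n).
have lN : last x t < (2 * n).+1 by lia.
rewrite lN !andbT negbK /flip /compl.
have bx := bt x (mem_head _ _).
by case: (odd n); case: (alt _ _ _ _); rewrite /= ?andbF ?andbT //=; lia.
Qed.

(** Invariance under [rc] is built into [psi]; alternation transfers because [tilde] is increasing
    on nonzero entries. *)
Lemma is_snake_psi n p : 0 < n -> size p = n ->
    {in p, forall x, 0 < absz x <= n} ->
  is_snake n p <-> rc_alt n (psi n p).
Proof.
move=> n0 sp bp; set t := map (flip n \o tilde n) p.
have st : size t = n by rewrite size_map.
have bt : {in t, forall x, 0 < x <= 2 * n}.
  by move=> _ /mapP[x /bp bx ->]; apply: flip_bounds; apply: tilde_bounds.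
have permE : perm_eq (map absz p) (iota 1 n) =
             perm_eq (psi n p) (iota 1 (2 * n)).
  rewrite psiE // perm_rc_cat // -map_comp; congr (perm_eq _ _).
  apply/eq_in_map => x /bp bx /=; rewrite /flip; case: (odd n); last by rewrite tildeK.
  by rewrite absz_untilde_compl ?tildeK ?tilde_bounds.
have altE : (0 < nth 0 p 0)%R && all (fun i => if odd i then (nth 0 p i < nth 0 p i.+1)%R
                    else (nth 0 p i.+1 < nth 0 p i)%R) (iota 0 n.-1) =
    alt ltn true 0 (rcons (psi n p) (2 * n).+1).
  case: p sp bp @t st bt {permE} => [|x p] sp bp; first by move: n0; rewrite -sp.
  move=> t st bt; rewrite psiE //= alt_rc_cat //; last by rewrite size_map -sp.
  have {}sp : n.-1 = size p by rewrite -sp.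
  have bx := bp x (mem_head _ _).
  have flipt y : y \in x :: p -> flip n (flip n (tilde n y)) = tilde n y.
    by move/bp/tilde_bounds => by_; rewrite flipK //; lia.
  rewrite -map_comp flipt ?mem_head //; congr (_ && _).
    by rewrite /tilde; case: ifP => ?; lia.
  have -> : map (flip n \o (flip n \o tilde n)) p = map (tilde n) p.
    by apply/eq_in_map => y yp /=; rewrite flipt // in_cons yp orbT.
  rewrite (alt_map (r := fun a b : int => (a < b)%R)); last first.
    by move=> a b /bp ba /bp bb; apply: ltn_tilde.
  rewrite -(alt_nth _ 0%R) sp; apply: eq_all => i.
  by rewrite addbF.
have rcE : rc n (psi n p) = psi n p.
  rewrite psiE // -/t [LHS]/rc rev_cat map_cat -/(rc n t) -/(rc n (rc n t)) rcK //.
  by move=> x /bt; lia.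
rewrite /is_snake sp eqxx permE altE /=; split=> [/andP[? ?]|[-> -> _]//].
by split.
Qed.

Lemma is_snake_bounds n p : is_snake n p ->
  size p = n /\ {in p, forall x, 0 < absz x <= n}.
Proof.
case/and4P=> /eqP sp pp _ _; split=> // x xp.
by have := map_f absz xp; rewrite (perm_mem pp) mem_iota; lia.
Qed.

(** * The bijection between snakes and labeled ballot paths *)

Lemma PsiE n s : Psi n s =
  let q := [seq (Psi_m s i, Psi_w s i) | i <- iota 1 n] in (unzip1 q, unzip2 q).
Proof. by rewrite /Psi /unzip1 /unzip2 /= -!map_comp. Qed.

Theorem theorem3p5 (n : nat) : 1 <= n ->
  [/\ (forall p, is_snake n p -> is_ballot n (Psi n (psi n p))),
      (forall p1 p2, is_snake n p1 -> is_snake n p2 ->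
          Psi n (psi n p1) = Psi n (psi n p2) -> p1 = p2)
    & (forall q, is_ballot n q ->
          exists2 p, is_snake n p & Psi n (psi n p) = q)].
Proof.
move=> n0; pose code s := [seq (Psi_m s i, Psi_w s i) | i <- iota 1 n].
have size_code s : size (code s) = n by rewrite size_map size_iota.
have le_n : n <= 2 * n by rewrite leq_pmull.
have reach_code s : rc_alt n s -> reach (code s) (runs (leq^~ n) (padded n s)).
  by case=> ps alts _; apply: reach_Psi.
have rc_psi p : is_snake n p -> rc_alt n (psi n p).
  by move=> sn; have [sp bp] := is_snake_bounds sn; apply/is_snake_psi.
split=> [p /rc_psi/reach_code/reach_ballot[]|p1 p2 sn1 sn2|[m w] bq].
- by rewrite size_code PsiE.
- rewrite !PsiE => -[E1 E2].
  have E : code (psi n p1) = code (psi n p2).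
    by rewrite -[LHS]zip_unzip -[RHS]zip_unzip /code E1 E2.
  have [s1 b1] := is_snake_bounds sn1; have [s2 b2] := is_snake_bounds sn2.
  (* Equal codes reach the same blocks, and these determine the permutation. *)
  rewrite -(psiK s1 b1) -(psiK s2 b2); congr unpsi.
  apply: rc_alt_inj; try exact: rc_psi.
  apply: reach_det (reach_code _ (rc_psi _ sn1)) _.
  by rewrite E; apply/reach_code/rc_psi.
have /and4P[/= /eqP sm /eqP sw _ _] := bq.
have [bs r] := ballot_reach bq.
have sq : size (zip m w) = n by rewrite size_zip sm sw minnn.
have [s rcs runs_s] := rc_alt_of_blocks sq r.
(* The code of [s] and the given one have equal length and reach the same blocks. *)
have codeE : code s = zip m w.
  apply: reach_inj (reach_code _ rcs) _; first by rewrite size_code sq.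
  by rewrite runs_s.
have [ps _ _] := rcs.
exists (unpsi n s); last first.
  by rewrite unpsiK // PsiE -/(code s) codeE /= unzip1_zip ?unzip2_zip ?sm ?sw.
apply/is_snake_psi; rewrite ?unpsiK //.
  by rewrite size_map size_drop (perm_size ps) size_iota; lia.
move=> _ /mapP[x /mem_drop xs ->] /=; apply: absz_untilde; apply: flip_bounds.
by move: xs; rewrite (perm_mem ps) mem_iota; lia.
Qed.
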